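(* Let $\mathcal{P}$ be the graph with vertices $a,b,c$, edges $\{a,b\}$ and $\{b,c\}$, and a loop at $c$. For every positive integer $k$, the number of maximal configurations of the Riviera model (of any length $n\ge1$) with exactly $k$ occupied lots equals the number of closed walks of length $k+4$ in $\mathcal{P}$ that start and end at the vertex $a$ (the vertex of degree $1$). Moreover, there is an explicit bijection between these two sets.
   Context: Riviera model: a configuration of length $n$ is a word $C=(c_1,\dots,c_n)\in\{0,1\}^n$ ($c_i=1$: lot $i$ occupied; $c_i=0$: empty), with $c_j=0$ for $j\le 0$ and $j\ge n+1$. $C$ is permissible if there is no $i\in\{1,\dots,n\}$ with $c_{i-1}=c_i=c_{i+1}=1$. $C$ is maximal if it is permissible and for every $i$ with $c_i=0$, changing $c_i$ to $1$ yields a non-permissible configuration. The number of occupied lots is $\sum_i c_i$. A walk of length $\ell$ is a sequence of $\ell+1$ vertices, consecutive ones joined by an edge (the loop allows $c\to c$). *)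

(* Defs.v *)
From HB Require Import structures.
From mathcomp Require Import all_boot.
From mathcomp Require Import boolp classical_sets functions cardinality.

Set Implicit Arguments.
Unset Strict Implicit.
Unset Printing Implicit Defensive.

(* A configuration (c_1, ..., c_n) is a word C : seq bool with n = size C.
   Lots are numbered from 1, so c_i is entry i.-1 of C, and c_i = 0 for i = 0
   and for i > n. *)
Definition lot (C : seq bool) (i : nat) : bool := nth false (false :: C) i.

Definition permissible (C : seq bool) : Prop :=
  ~ exists i, [/\ 1 <= i <= size C, lot C i.-1, lot C i & lot C i.+1].

Definition occupy (C : seq bool) (i : nat) : seq bool :=
  set_nth false C i.-1 true.

Definition maximal (C : seq bool) : Prop :=
  permissible C /\
  forall i, 1 <= i <= size C -> lot C i = false -> ~ permissible (occupy C i).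

Definition occupied (C : seq bool) : nat := \sum_(1 <= i < (size C).+1) lot C i.

Definition maximal_configurations (k : nat) : set (seq bool) :=
  [set C | [/\ 1 <= size C, maximal C & occupied C = k]]%classic.

Inductive vertex : Type := Va | Vb | Vc.

Definition vertex_ord (x : vertex) : 'I_3 :=
  match x with Va => inord 0 | Vb => inord 1 | Vc => inord 2 end.

Definition ord_vertex (i : 'I_3) : vertex :=
  match val i with 0 => Va | 1 => Vb | _ => Vc end.

Lemma vertex_ordK : cancel vertex_ord ord_vertex.
Proof. by case; rewrite /ord_vertex /= inordK. Qed.

HB.instance Definition _ := Finite.copy vertex (can_type vertex_ordK).

Definition adj (x y : vertex) : bool :=
  match x, y with
  | Va, Vb | Vb, Va | Vb, Vc | Vc, Vb | Vc, Vc => true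
  | _, _ => false
  end.

(* A walk of length l is the sequence of its l.+1 vertices; the default value
   of nth is never used. *)
Definition closed_walks (V : Type) (e : rel V) (v : V) (l : nat) :
    set (seq V) :=
  [set w | [/\ size w = l.+1, sorted e w, nth v w 0 = v & nth v w l = v]]%classic.

(* The bijection. Surround C with occupied pairs to form 1 1 0 C 0 1 1, with
   empty lots outside. Label each occupied lot according to the two lots on its
   left: b if the adjacent one is occupied, c if only the adjacent one is empty,
   a if both are empty. The walk lists the labels from left to right and then
   returns to a. In lot_labels, p2 and p1 are the two lots preceding s, p1
   being the nearer one. *)
Definition lot_label (p2 p1 : bool) : vertex :=
  if p1 then Vb else if p2 then Vc else Va.

Fixpoint lot_labels (p2 p1 : bool) (s : seq bool) : seq vertex :=
  if s is d :: s' then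
    let t := lot_labels p1 d s' in if d then lot_label p2 p1 :: t else t
  else [::].

Definition walk_of_configuration (C : seq bool) : seq vertex :=
  rcons (lot_labels false false
          ([:: true; true; false] ++ C ++ [:: false; true; true])) Va.

(* Main.v *)
(** Cut the padded word [1 1 0 C 0 1 1] after each occupied lot.  A word in
    which every empty lot is blocked has at most two empty lots between
    consecutive occupied ones, so a block is [1], [01] or [001]: exactly the
    blocks labelled [b], [c] and [a].  Permissibility forbids [bb], an empty lot
    in a block [01] is always blocked, and the two in a block [001] are blocked
    iff the block is preceded and followed by [b].  These are the adjacencies of
    the graph, and decoding labels into blocks inverts the map. *)
Require Import Defs.
From mathcomp Require Import all_boot.
From mathcomp Require Import boolp classical_sets functions cardinality.

Local Open Scope classical_set_scope.
Local Open Scope card_scope.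

(* [p2] and [p1] are the two lots preceding [s], as in [lot_labels]. *)
Fixpoint blocked (p2 p1 : bool) (s : seq bool) : bool :=
  if s is d :: s' then
    (if d then ~~ (p2 && p1)
     else [|| p2 && p1, p1 && nth false s' 0 | nth false s' 0 && nth false s' 1])
    && blocked p1 d s'
  else true.

(** Concerns the lot at entry [i.+2], the shift leaving room for the two lots before the word. For
    an empty lot, the disjuncts are the three triples that filling it could complete. *)
Definition blocked_at (s : seq bool) (i : nat) : bool :=
  if nth false s i.+2 then ~~ (nth false s i && nth false s i.+1)
  else [|| nth false s i && nth false s i.+1,
           nth false s i.+1 && nth false s i.+3
         | nth false s i.+3 && nth false s i.+4].

Lemma blockedP p2 p1 s :
  reflect (forall i, i < size s -> blocked_at [:: p2, p1 & s] i)
          (blocked p2 p1 s).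
Proof.
elim: s p2 p1 => [|d s IHs] p2 p1 /=; first by apply: ReflectT.
apply: (iffP andP) => [[h0 /IHs hs] [|i] //|h].
  by move=> lis; apply: (hs i).
split; first exact: (h 0).
by apply/IHs => i lis; apply: (h i.+1).
Qed.

Lemma permissibleP C :
  permissible C <-> forall i, ~~ [&& lot C i, lot C i.+1 & lot C i.+2].
Proof.
split=> [pC i|h [[|i] [// _ a b c]]]; last by have := h i; rewrite a b c.
apply/negP => /and3P[a b c]; apply: pC; exists i.+1; split=> //=.
by rewrite ltnNge; apply/negP => le; move: b; rewrite /lot /= nth_default.
Qed.

Lemma lot_occupy C i j : lot (occupy C i.+1) j = (j == i.+1) || lot C j.
Proof.
case: j => [|j] //; rewrite /lot /occupy /= nth_set_nth /= eqSS.
by case: (j == i).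
Qed.

Lemma nth_lot C i : nth false [:: false, false & C] i = lot C i.-1.
Proof. by case: i. Qed.

Lemma maximal_blocked C : maximal C <-> blocked false false C.
Proof.
split=> [[/permissibleP pC mC]|/blockedP h].
  apply/blockedP => i lis; rewrite /blocked_at !nth_lot /=.
  case: ifP => li.
    case: i li {lis} => [|i] li //=; apply/negP => /andP[a b].
    by have := pC i; rewrite a b li.
  apply: contra_notT (mC i.+1 lis li) => hN.
  apply/permissibleP => j; rewrite !lot_occupy; have := pC j.
  (* The case splits place the newly occupied lot first, middle and last in the triple that starts
     at lot [j]. *)
  rewrite !eqSS; case: (eqVneq j i.+1) => [->|_] /=.
    rewrite eqn_leq ltnn /= eqn_leq ltnNge leqnSn /= => _.
    by apply: contra hN => /andP[-> ->]; rewrite !orbT.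
  case: (eqVneq j i) => [->|_] /=.
    rewrite eqn_leq ltnn /= => _.
    by apply: contra hN => /andP[-> ->]; rewrite !orbT.
  case: (eqVneq j.+1 i) => [ji|_] //= _; move: hN; rewrite -ji /=.
  by apply: contra => /and3P[-> -> _].
split.
  apply/permissibleP => i; apply/negP => /and3P[a b c].
  have lis : i.+1 < size C.
    by rewrite ltnNge; apply/negP => le; move: c; rewrite /lot /= nth_default.
  by have := h _ lis; rewrite /blocked_at !nth_lot /= c a b.
move=> [//|i] lis li /permissibleP pO.
have := h _ lis; rewrite /blocked_at !nth_lot /= li.
case/or3P => /andP[a b].
- case: i a b {lis li h} pO => [//|i] a b pO.
  by have := pO i; rewrite !lot_occupy eqxx a b !orbT.
- by have := pO i; rewrite !lot_occupy eqxx a b !orbT.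
- by have := pO i.+1; rewrite !lot_occupy eqxx a b !orbT.
Qed.

Lemma occupied_count C : occupied C = count id C.
Proof.
rewrite /occupied big_add1 /= -sumn_count sumnE big_map (big_nth false).
by apply: eq_bigr => i _; rewrite /lot.
Qed.

Lemma blocked_after_empty p2 p2' s : blocked p2 false s = blocked p2' false s.
Proof. by case: s => [|[] s] //=; rewrite !andbF. Qed.

(** The first added lot is empty, as is the default of [nth], so no triple through a lot of [s]
    reaches the final pair; that pair blocks the added empty lot. *)
Lemma blocked_cat011 p2 p1 s :
  blocked p2 p1 (s ++ [:: false; true; true]) = blocked p2 p1 s.
Proof.
elim: s p2 p1 => [|d s IHs] p2 p1 /=; first by rewrite !andbF !orbT.
by rewrite IHs; case: s {IHs} => [|d1 [|d2 s]] //=; rewrite !andbF.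
Qed.

Lemma size_lot_labels p2 p1 s : size (lot_labels p2 p1 s) = count id s.
Proof. by elim: s p2 p1 => [|[] s IHs] p2 p1 //=; rewrite IHs. Qed.

Lemma lot_labels_cat11 p2 p1 s :
  exists t, lot_labels p2 p1 (s ++ [:: true; true]) = rcons t Vb.
Proof.
elim: s p2 p1 => [|d s IHs] p2 p1 /=; first by exists [:: lot_label p2 p1].
by have [t ->] := IHs p1 d; case: d; [exists (lot_label p2 p1 :: t)|exists t].
Qed.

Definition label_block (x : vertex) : seq bool :=
  match x with
  | Va => [:: false; false; true]
  | Vb => [:: true]
  | Vc => [:: false; true]
  end.

Definition decode (v : seq vertex) : seq bool := flatten (map label_block v).

(** Every block ends with an occupied lot, so the next block is again read with [p1] true. *)
Lemma lot_labels_decode p2 v : lot_labels p2 true (decode v) = v.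
Proof. by elim: v p2 => [|[] v IHv] p2 //=; rewrite /decode /= IHv. Qed.

Lemma count_decode v : count id (decode v) = size v.
Proof. by rewrite -(size_lot_labels false true) lot_labels_decode. Qed.

(** Induction on leading blocks. The last three cases are the nonempty words that begin with no
    block; in the uses below an occupied last lot excludes the first two, and the unblocked middle
    lot of [000] the third. *)
Lemma block_ind (P : seq bool -> Prop) :
  P [::] -> (forall s, P s -> P (true :: s)) ->
  (forall s, P s -> P [:: false, true & s]) ->
  (forall s, P s -> P [:: false, false, true & s]) ->
  P [:: false] -> P [:: false; false] ->
  (forall s, P [:: false, false, false & s]) ->
  forall s, P s.
Proof.
move=> P0 P1 P2 P3 N1 N2 N3 s; have [n] := ubnP (size s).
elim: n s => // n IHn [|[] s] //= lsn; first exact/P1/IHn.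
case: s lsn => [|[] s] //= lsn; first exact/P2/IHn/ltnW.
by case: s lsn => [|[] s] //= lsn; apply/P3/IHn/ltnW/ltnW.
Qed.

Lemma decode_lot_labels p2 s :
  blocked p2 true s -> last true s -> decode (lot_labels p2 true s) = s.
Proof.
elim/block_ind: s p2 => //=.
- by move=> s IHs p2 /andP[_ /IHs h] /h; rewrite /decode /= => ->.
- by move=> s IHs p2 /andP[_ /IHs h] /h; rewrite /decode /= => ->.
- move=> s IHs p2 /and3P[_ _ bs] ls.
  by rewrite /decode /= -/(decode _) IHs.
- by move=> s p2; rewrite andbF.
Qed.

Definition is_b (x : vertex) : bool := if x is Vb then true else false.

(* The hypothesis on [Va] records what the empty lots before [x] require of [s];
   [blocked] only constrains lots of [s] itself. *)
Lemma path_lot_labels (x : vertex) s :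
  (x = Va -> nth false s 0) -> blocked (is_b x) true s -> last true s ->
  path adj x (lot_labels (is_b x) true s).
Proof.
elim/block_ind: s x => //=.
- move=> s IHs x _ /andP[xb bs] ls; apply/andP; split; last exact: (IHs Vb).
  by case: x xb {bs}.
- move=> s IHs x xa /andP[_ bs] ls; rewrite (IHs Vc) // andbT.
  by case: x xa => // /(_ erefl).
(* Blocking the first empty lot forces [x = Vb]; blocking the second gives [s0], the hypothesis
   needed at [Va]. *)
- move=> s IHs x _ /and3P[xb s0 bs] ls; rewrite (IHs Va) // andbT.
  by case: x xb.
- by move=> s x _; rewrite andbF.
Qed.

(** The closing [Va] prevents a final block [001], whose second empty lot nothing would block: each
    [Va] in [v] is followed by [Vb]. *)
Lemma blocked_decode (x : vertex) v :
  path adj x (rcons v Va) -> blocked (is_b x) true (decode v).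
Proof.
elim: v x => [|y v IHv] x //= /andP[axy yv]; have := IHv y yv.
by case: y axy yv; rewrite /decode; case: x => //= _;
   case: v {IHv} => [|[] v] //=.
Qed.

Lemma finite_closed_walks (V : finType) (e : rel V) v l :
  finite_set (closed_walks e v l).
Proof.
apply: (@sub_finite_set _ _ [set tval t | t in [set: l.+1.-tuple V]]).
  by move=> w [/eqP sw _ _ _]; exists (Tuple sw).
exact/finite_image/finite_finset.
Qed.

(** The leading pair yields [Va], [Vb]; the rest is read after an occupied lot, as [decode]
    requires. *)
Lemma walk_of_configurationE C :
  walk_of_configuration C =
  [:: Va, Vb & rcons (lot_labels true true
                       (false :: C ++ [:: false; true; true])) Va].
Proof. by []. Qed.

Lemma maximal_blocked_pad C :
  maximal C -> blocked true true (false :: C ++ [:: false; true; true]).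
Proof.
by move/maximal_blocked; rewrite -blocked_cat011 (blocked_after_empty _ true).
Qed.

Lemma walk_of_configuration_fun k :
  set_fun (maximal_configurations k) (closed_walks adj Va (k + 4))
    walk_of_configuration.
Proof.
move=> C [_ /maximal_blocked_pad bC kC]; rewrite walk_of_configurationE.
have sz : size (lot_labels true true (false :: C ++ [:: false; true; true]))
          = k.+2.
  by rewrite size_lot_labels /= count_cat -occupied_count kC /= !addnS addn0.
split=> //.
- by rewrite /= size_rcons sz !addnS addn0.
- rewrite /= rcons_path; apply/andP; split.
    by apply: (path_lot_labels Vb (false :: _)) => //=; rewrite last_cat.
  have [t et] := lot_labels_cat11 true true (false :: C ++ [:: false]).
  by move: et; rewrite /= -catA => ->; rewrite last_rcons.
- by rewrite !addnS addn0 [LHS]/= nth_rcons sz ltnn eqxx.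
Qed.

Lemma walk_of_configuration_inj k :
  set_inj (maximal_configurations k) walk_of_configuration.
Proof.
move=> C D /set_mem[_ /maximal_blocked_pad bC _].
move=> /set_mem[_ /maximal_blocked_pad bD _].
have pad_last s : last true (false :: s ++ [:: false; true; true]).
  by rewrite /= last_cat.
have := decode_lot_labels _ _ bC (pad_last C).
have := decode_lot_labels _ _ bD (pad_last D).
rewrite !walk_of_configurationE => eD eC [] /rcons_inj[] eCD.
(* Reversal turns the common suffix [011] into a prefix, removed by injectivity of cons. *)
have [/(congr1 rev)] := etrans (esym eC) (etrans (congr1 decode eCD) eD).
by rewrite !rev_cat => -[] /(can_inj revK).
Qed.

Lemma walk_of_configuration_surj k : 0 < k ->
  set_surj (maximal_configurations k) (closed_walks adj Va (k + 4))
    walk_of_configuration.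
Proof.
move=> k0 w [sw].
(* The walk is split as [x y w c y' z] with [w] of length [k]; the ends are [Va], so [y] and [y']
   are [Vb]. *)
case: w sw => [|x [|y w]]; rewrite ?addnS // => -[].
case/lastP: w => [|w z] //; rewrite size_rcons => -[].
case/lastP: w => [|w y'] //; rewrite size_rcons => -[].
case/lastP: w => [|w c] //; rewrite size_rcons addn0.
move=> [sw] /= /andP[xy wP] xE; subst x.
rewrite nth_rcons !size_rcons sw ltnn eqxx => zE; subst z.
case: y xy wP => // _ wP.
have bw : blocked true true (decode (rcons (rcons w c) y')).
  exact: blocked_decode Vb _ wP.
move: wP; rewrite !rcons_path !last_rcons => /andP[/andP[/andP[wP wc] cy] yz].
case: y' cy yz bw => // cb _ bw.
(* As [k > 0], [w] has a first label; it follows [Vb], so its block starts with the empty lot of the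
   left padding. *)
have [t1 e1] : exists t1, decode w = false :: t1.
  case: w wP sw {wc bw} => [|[] w] //=; first by move=> _ e; rewrite -e in k0.
    by exists [:: false, true & decode w].
  by exists (true :: decode w).
(* Being adjacent to [Vb], [c] has a block ending in [01], which joins the last [1] to form the
   right padding; what remains of the block has no occupied lot. *)
have [t2 e2 n2] : exists2 t2, label_block c = t2 ++ [:: false; true]
                              & count id t2 = 0.
  by case: c cb {wc bw} => // _; [exists [:: false]|exists [::]].
have eW : decode (rcons (rcons w c) Vb)
          = false :: (t1 ++ t2) ++ [:: false; true; true].
  rewrite -!cats1 -!catA /decode map_cat flatten_cat -/(decode w) e1 /=.
  by rewrite e2 -!catA.
have n1 : count id t1 = k by rewrite -sw -count_decode e1.
have nC : count id (t1 ++ t2) = k by rewrite count_cat n1 n2 addn0.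
exists (t1 ++ t2); last first.
  by rewrite walk_of_configurationE -eW lot_labels_decode.
split; last by rewrite occupied_count.
- by apply: leq_trans (count_size id _); rewrite nC.
- apply/maximal_blocked; rewrite -blocked_cat011 (blocked_after_empty _ true).
  by move: bw; rewrite eW.
Qed.

Theorem theorem2p4 (k : nat) (hk : 0 < k) :
  (exists N : nat,
     maximal_configurations k #= `I_N /\ closed_walks adj Va (k + 4) #= `I_N) /\
  set_bij (maximal_configurations k) (closed_walks adj Va (k + 4))
    walk_of_configuration.
Proof.
have bij : set_bij (maximal_configurations k) (closed_walks adj Va (k + 4))
             walk_of_configuration.
  split; [exact: walk_of_configuration_fun|exact: walk_of_configuration_inj|].
  exact: walk_of_configuration_surj.
split=> //; have [N wN] := finite_closed_walks _ adj Va (k + 4).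
exists N; split=> //; apply: card_eq_trans wN.
exact: pcard_eq bij.
Qed.
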